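(* Let $\mathcal M_q$ be a quantum matrix algebra of the family described in the context, with defining matrix $H_{\mathcal M}=(H_{\alpha j,\beta k})$ of its associated quasi-polynomial algebra, and let $\Lambda_{\mathcal M}=(\Lambda_{\alpha j,\beta k})$ be the integer skew-symmetric matrix given by $\chi_{\alpha j}\chi_{\beta k}=q^{\Lambda_{\alpha j,\beta k}}\chi_{\beta k}\chi_{\alpha j}$ for the quantum minors $\chi_{\alpha j}\in\mathcal M_q$ ($1\le\alpha\le n$, $1\le j\le r$). Then $$\Lambda_{\mathcal M}=\mathbb T^{t}H_{\mathcal M}\mathbb T,$$ where $\mathbb T=(\mathbb T_{\beta k,\alpha j})$ is the $nr\times nr$ upper triangular matrix, with entries either $1$ or $0$, given by $$\mathbb T_{\beta k,\alpha j}=\begin{cases}1 & \text{if there is } x\in\{0,1,\dots,\min\{\alpha,j\}-1\}\text{ with }(\beta,k)=(\alpha-x,j-x),\\ 0&\text{otherwise.}\end{cases}$$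
   Context: Let $n,r$ be positive integers and let $q$ be a fixed non-zero complex number. The algebras below are viewed as defined over $\mathbb C$, with $q$ a so-called dummy parameter; the possibility that $q$ is a root of unity is left open. Greek indices run over $1,\dots,n$, Latin indices over $1,\dots,r$. Pairs $(\alpha,j)$ are ordered lexicographically: $(1,1),\dots,(1,r),(2,1),\dots,(n,r)$. FRT algebra. $\mathcal O_q(M(n,r))$ is the associative $\mathbb C$-algebra generated by $Z_{\alpha j}$ with relations: $Z_{\alpha j}Z_{\alpha k}=qZ_{\alpha k}Z_{\alpha j}$ for $j<k$; $Z_{\alpha j}Z_{\beta j}=qZ_{\beta j}Z_{\alpha j}$ for $\alpha<\beta$; $Z_{\alpha j}Z_{\beta l}=Z_{\beta l}Z_{\alpha j}$ for $\alpha>\beta,\ j<l$; $Z_{\alpha j}Z_{\beta l}=Z_{\beta l}Z_{\alpha j}+(q-q^{-1})Z_{\alpha l}Z_{\beta j}$ for $\alpha<\beta,\ j<l$. Extended algebra. $\mathcal P_q$ is generated by $\mathcal O_q(M(n,r))$ and mutually commuting invertible elements $R_\alpha^{\pm1}$, $C_j^{\pm1}$ with $R_\alpha Z_{\beta i}=q^{\delta_{\alpha\beta}}Z_{\beta i}R_\alpha$, $C_jZ_{\alpha i}=q^{\delta_{ji}}Z_{\alpha i}C_j$. The algebra $\mathcal M_q$. For every $(\alpha,j)$ a Laurent monomial $M_{\alpha j}$ in the $R_\beta^{\pm1},C_i^{\pm 1}$ is fixed, of the form $M_{\alpha j}=\mathcal R_\alpha\mathcal R'_j\mathcal C_\alpha\mathcal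 C'_j$, where $\mathcal R_\alpha,\mathcal R'_j$ are Laurent monomials in the row operators $R_\beta$ and $\mathcal C_\alpha,\mathcal C'_j$ are Laurent monomials in the column operators $C_i$ (depending only on $\alpha$, respectively only on $j$). Define integers $\Phi_{\alpha j}^{\beta i}$ by $M_{\alpha j}Z_{\beta i}=q^{\Phi_{\alpha j}^{\beta i}}Z_{\beta i}M_{\alpha j}$, and assume $\Phi_{\alpha j}^{\alpha j}=0$ for all $\alpha,j$. Then $\mathcal M_q$ is the subalgebra of $\mathcal P_q$ generated by $W_{\alpha j}:=Z_{\alpha j}M_{\alpha j}$. Associated quasi-polynomial algebra. $\overline{\mathcal M}_q$ is the algebra generated by $w_{\alpha j}$ whose relations are obtained from those of $\mathcal M_q$ by dropping the extra term (the one coming from $(q-q^{-1})Z_{\alpha l}Z_{\beta j}$) in the last family of relations. The relations thus read $w_{\alpha j}w_{\beta k}=q^{H_{\alpha j,\beta k}}w_{\beta k}w_{\alpha j}$, which defines the $nr\times nr$ integer skew-symmetric matrix $H_{\mathcal M}$. Explicitly, $H_{\alpha j,\beta k}=h_{\alpha j,\beta k}+\Phi_{\alpha j}^{\beta k}-\Phi_{\beta k}^{\alpha j}$, where $h$ is skew-symmetric with $h_{\alpha j,\alpha k}=1$ for $j<k$, $h_{\alpha j,\beta j}=1$ for $\alpha<\beta$, and $h_{\alpha j,\beta k}=0$ if $\alpha\ne\beta$ and $j\neq k$. Quantum minors. For $\boldsymbol\alpha=\{\alpha_1<\dots<\alpha_m\}$ and $\mathbf j=\{j_1<\dots<j_m\}$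 put $\xi^{\boldsymbol\alpha}_{\mathbf j}=\sum_{\sigma\in S_m}(-q)^{\ell(\sigma)}Z_{\alpha_1,j_{\sigma(1)}}\cdots Z_{\alpha_m,j_{\sigma(m)}}$, with $\ell(\sigma)$ the length of $\sigma$, and $\chi^{\boldsymbol\alpha}_{\mathbf j}=q^{a}\,\xi^{\boldsymbol\alpha}_{\mathbf j}\,M_{\alpha_1j_1}\cdots M_{\alpha_mj_m}\in\mathcal M_q$, with the integer $a$ chosen so that $\chi^{\boldsymbol\alpha}_{\mathbf j}$ is invariant under the bar anti-automorphism (which fixes all $Z_{\alpha j},R_\alpha,C_j$ and sends $q$ to $q^{-1}$). Put $\chi_{\alpha j}=\chi^{\{\alpha-j+1,\dots,\alpha\}}_{\{1,\dots,j\}}$ if $\alpha\ge j$ and $\chi_{\alpha j}=\chi^{\{1,\dots,\alpha\}}_{\{j-\alpha+1,\dots,j\}}$ if $\alpha<j$. Any two of these $nr$ elements commute up to a power of $q$, and the exponents define the skew-symmetric integer matrix $\Lambda_{\mathcal M}$. *)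

(* Defs.v *)
From HB Require Import structures.
From mathcomp Require Import all_boot all_order all_algebra.
From mathcomp Require Import all_fingroup generic_quotient.
From mathcomp Require Import boolp reals complex.

Set Implicit Arguments.
Unset Strict Implicit.
Unset Printing Implicit Defensive.

Import Order.TTheory GRing.Theory Num.Theory.
Local Open Scope ring_scope.
Local Open Scope quotient_scope.

(* Indices are 0-based throughout: Greek indices range over 'I_n, Latin ones   *)
(* over 'I_r.                                                                  *)

(* Generators of P_q; [GRinv], [GCinv] are the inverses of [GR], [GC]. *)
Inductive gen (n r : nat) : Type :=
  | GZ of 'I_n & 'I_r
  | GR of 'I_n
  | GRinv of 'I_n
  | GC of 'I_r
  | GCinv of 'I_r.

Inductive term (K : Type) (n r : nat) : Type :=
  | TCst of K
  | TGen of gen n r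
  | TAdd of term K n r & term K n r
  | TMul of term K n r & term K n r.

Arguments TCst {K n r}.
Arguments TGen {K n r}.
Arguments GZ {n r}.
Arguments GR {n r}.
Arguments GRinv {n r}.
Arguments GC {n r}.
Arguments GCinv {n r}.

HB.instance Definition _ (K : Type) n r := gen_eqMixin (term K n r).
HB.instance Definition _ (K : Type) n r := gen_choiceMixin (term K n r).

Section Presentation.
Variables (K : fieldType) (n r : nat).
Implicit Types (q a b : K) (x y z : term K n r).

Let Z (al : 'I_n) (j : 'I_r) : term K n r := TGen (GZ al j).
Let Ro (al : 'I_n) : term K n r := TGen (GR al).
Let Ri (al : 'I_n) : term K n r := TGen (GRinv al).
Let Co (j : 'I_r) : term K n r := TGen (GC j).
Let Ci (j : 'I_r) : term K n r := TGen (GCinv j).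

Inductive prel q : term K n r -> term K n r -> Prop :=
  | prel_row (al : 'I_n) (j k : 'I_r) : (j < k)%N ->
      prel q (TMul (Z al j) (Z al k)) (TMul (TCst q) (TMul (Z al k) (Z al j)))
  | prel_col (al be : 'I_n) (j : 'I_r) : (al < be)%N ->
      prel q (TMul (Z al j) (Z be j)) (TMul (TCst q) (TMul (Z be j) (Z al j)))
  | prel_anti (al be : 'I_n) (j l : 'I_r) : (be < al)%N -> (j < l)%N ->
      prel q (TMul (Z al j) (Z be l)) (TMul (Z be l) (Z al j))
  | prel_diag (al be : 'I_n) (j l : 'I_r) : (al < be)%N -> (j < l)%N ->
      prel q (TMul (Z al j) (Z be l))
        (TAdd (TMul (Z be l) (Z al j))
              (TMul (TCst (q - q^-1)) (TMul (Z al l) (Z be j))))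
  | prel_RZ (al be : 'I_n) (i : 'I_r) :
      prel q (TMul (Ro al) (Z be i))
             (TMul (TCst (q ^+ (al == be))) (TMul (Z be i) (Ro al)))
  | prel_CZ (j i : 'I_r) (al : 'I_n) :
      prel q (TMul (Co j) (Z al i))
             (TMul (TCst (q ^+ (j == i))) (TMul (Z al i) (Co j)))
  | prel_RR (al be : 'I_n) : prel q (TMul (Ro al) (Ro be)) (TMul (Ro be) (Ro al))
  | prel_CC (i j : 'I_r) : prel q (TMul (Co i) (Co j)) (TMul (Co j) (Co i))
  | prel_RC (al : 'I_n) (j : 'I_r) :
      prel q (TMul (Ro al) (Co j)) (TMul (Co j) (Ro al))
  | prel_RV (al : 'I_n) : prel q (TMul (Ro al) (Ri al)) (TCst 1)
  | prel_VR (al : 'I_n) : prel q (TMul (Ri al) (Ro al)) (TCst 1)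
  | prel_CV (j : 'I_r) : prel q (TMul (Co j) (Ci j)) (TCst 1)
  | prel_VC (j : 'I_r) : prel q (TMul (Ci j) (Co j)) (TCst 1).

(* The smallest congruence on expressions that contains the axioms of unital   *)
(* associative K-algebras and the defining relations; [TMul (TCst a) x] plays  *)
(* the role of [a *: x].                                                       *)
Inductive pcong q : term K n r -> term K n r -> Prop :=
  | pc_rel x y : prel q x y -> pcong q x y
  | pc_refl x : pcong q x x
  | pc_sym x y : pcong q x y -> pcong q y x
  | pc_trans x y z : pcong q x y -> pcong q y z -> pcong q x z
  | pc_add x x' y y' :
      pcong q x x' -> pcong q y y' -> pcong q (TAdd x y) (TAdd x' y')
  | pc_mul x x' y y' :
      pcong q x x' -> pcong q y y' -> pcong q (TMul x y) (TMul x' y')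
  | pc_addA x y z : pcong q (TAdd x (TAdd y z)) (TAdd (TAdd x y) z)
  | pc_addC x y : pcong q (TAdd x y) (TAdd y x)
  | pc_add0 x : pcong q (TAdd (TCst 0) x) x
  | pc_addN x : pcong q (TAdd (TMul (TCst (-1)) x) x) (TCst 0)
  | pc_mulA x y z : pcong q (TMul x (TMul y z)) (TMul (TMul x y) z)
  | pc_mul1l x : pcong q (TMul (TCst 1) x) x
  | pc_mul1r x : pcong q (TMul x (TCst 1)) x
  | pc_mulDl x y z : pcong q (TMul (TAdd x y) z) (TAdd (TMul x z) (TMul y z))
  | pc_mulDr x y z : pcong q (TMul x (TAdd y z)) (TAdd (TMul x y) (TMul x z))
  | pc_cstD a b : pcong q (TCst (a + b)) (TAdd (TCst a) (TCst b))
  | pc_cstM a b : pcong q (TCst (a * b)) (TMul (TCst a) (TCst b))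
  | pc_cstC a x : pcong q (TMul (TCst a) x) (TMul x (TCst a)).

Definition pcongb q x y : bool := `[< pcong q x y >].

Lemma pcongb_equiv q : equiv_class_of (pcongb q).
Proof.
split.
- by move=> x; apply/asboolP; apply: pc_refl.
- by move=> x y; apply/asboolP/asboolP; apply: pc_sym.
- move=> y x z /asboolP xy /asboolP yz.
  by apply/asboolP; apply: pc_trans xy yz.
Qed.

Canonical pcongb_equiv_rel q := EquivRelPack (pcongb_equiv q).

Definition Pq q : Type := {eq_quot (pcongb_equiv_rel q)}.

HB.instance Definition _ q := EqQuotient.on (Pq q).
HB.instance Definition _ q := Choice.on (Pq q).

End Presentation.

Section Algebra.
Variables (K : fieldType) (n r : nat) (q : K).
Implicit Types (a b : K) (x y z : term K n r).

Local Notation P := (Pq n r q).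

Lemma Pq_eqP x y : (\pi_P x = \pi_P y) <-> pcong q x y.
Proof. by split=> [/eqmodP/asboolP | xy]; [ | apply/eqmodP/asboolP]. Qed.

Definition Pq_cst a : P := \pi_P (TCst a).
Definition Pq_gen (g : gen n r) : P := \pi_P (TGen g).
Fact Pq_key : unit. Proof. exact: tt. Qed.
Definition Pq_add : P -> P -> P :=
  locked_with Pq_key (fun u v => \pi_P (TAdd (repr u) (repr v))).
Definition Pq_mul : P -> P -> P :=
  locked_with Pq_key (fun u v => \pi_P (TMul (repr u) (repr v))).
Definition Pq_opp (u : P) : P := Pq_mul (Pq_cst (-1)) u.
Definition Pq_scale a (u : P) : P := Pq_mul (Pq_cst a) u.

Lemma Pq_repr x : pcong q (repr (\pi_P x)) x.
Proof. by apply/Pq_eqP; rewrite reprK. Qed.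

Lemma Pq_addE x y : Pq_add (\pi_P x) (\pi_P y) = \pi_P (TAdd x y).
Proof. by rewrite /Pq_add unlock; apply/Pq_eqP; apply: pc_add; apply: Pq_repr. Qed.

Lemma Pq_mulE x y : Pq_mul (\pi_P x) (\pi_P y) = \pi_P (TMul x y).
Proof. by rewrite /Pq_mul unlock; apply/Pq_eqP; apply: pc_mul; apply: Pq_repr. Qed.

Local Ltac pq_lift u := rewrite -[u]reprK; move: (repr u) => ?.
Local Ltac pq_solve c :=
  rewrite /Pq_opp /Pq_scale /Pq_cst !(Pq_addE, Pq_mulE); apply/Pq_eqP; eapply c.

Lemma Pq_addA : associative Pq_add.
Proof. by move=> u v w; pq_lift u; pq_lift v; pq_lift w; pq_solve pc_addA. Qed.
Lemma Pq_addC : commutative Pq_add.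
Proof. by move=> u v; pq_lift u; pq_lift v; pq_solve pc_addC. Qed.
Lemma Pq_add0 : left_id (Pq_cst 0) Pq_add.
Proof. by move=> u; pq_lift u; pq_solve pc_add0. Qed.
Lemma Pq_addN : left_inverse (Pq_cst 0) Pq_opp Pq_add.
Proof. by move=> u; pq_lift u; pq_solve pc_addN. Qed.
Lemma Pq_mulA : associative Pq_mul.
Proof. by move=> u v w; pq_lift u; pq_lift v; pq_lift w; pq_solve pc_mulA. Qed.
Lemma Pq_mul1l : left_id (Pq_cst 1) Pq_mul.
Proof. by move=> u; pq_lift u; pq_solve pc_mul1l. Qed.
Lemma Pq_mul1r : right_id (Pq_cst 1) Pq_mul.
Proof. by move=> u; pq_lift u; pq_solve pc_mul1r. Qed.
Lemma Pq_mulDl : left_distributive Pq_mul Pq_add.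
Proof. by move=> u v w; pq_lift u; pq_lift v; pq_lift w; pq_solve pc_mulDl. Qed.
Lemma Pq_mulDr : right_distributive Pq_mul Pq_add.
Proof. by move=> u v w; pq_lift u; pq_lift v; pq_lift w; pq_solve pc_mulDr. Qed.
Lemma Pq_cstD a b : Pq_cst (a + b) = Pq_add (Pq_cst a) (Pq_cst b).
Proof. by pq_solve pc_cstD. Qed.
Lemma Pq_cstM a b : Pq_cst (a * b) = Pq_mul (Pq_cst a) (Pq_cst b).
Proof. by pq_solve pc_cstM. Qed.
Lemma Pq_cstC a u : Pq_mul (Pq_cst a) u = Pq_mul u (Pq_cst a).
Proof. by pq_lift u; pq_solve pc_cstC. Qed.

(* P_q is not the zero ring: Z |-> 0, R, C |-> 1 defines a character. *)
Fixpoint term_aug x : K :=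
  match x with
  | TCst a => a
  | TGen (GZ _ _) => 0
  | TGen _ => 1
  | TAdd x y => term_aug x + term_aug y
  | TMul x y => term_aug x * term_aug y
  end.

Lemma term_aug_cong x y : pcong q x y -> term_aug x = term_aug y.
Proof.
elim=> {x y} /=.
- by move=> x y []*; rewrite /= ?(mulr0, mul0r, mulr1, addr0).
- by [].
- by move=> x y _ ->.
- by move=> x y z _ -> _ ->.
- by move=> x x' y y' _ -> _ ->.
- by move=> x x' y y' _ -> _ ->.
- by move=> *; rewrite addrA.
- by move=> *; rewrite addrC.
- by move=> *; rewrite add0r.
- by move=> *; rewrite mulN1r addNr.
- by move=> *; rewrite mulrA.
- by move=> *; rewrite mul1r.
- by move=> *; rewrite mulr1.
- by move=> *; rewrite mulrDl.
- by move=> *; rewrite mulrDr.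
- by [].
- by [].
- by move=> *; rewrite mulrC.
Qed.

Lemma Pq_nontrivial : Pq_cst 1 != Pq_cst 0.
Proof. by apply/eqP => /Pq_eqP/term_aug_cong/eqP; rewrite /= oner_eq0. Qed.

HB.instance Definition _ :=
  GRing.isZmodule.Build P Pq_addA Pq_addC Pq_add0 Pq_addN.
HB.instance Definition _ :=
  GRing.Zmodule_isNzRing.Build P
    Pq_mulA Pq_mul1l Pq_mul1r Pq_mulDl Pq_mulDr Pq_nontrivial.

Fact Pq_scaleA a b (u : P) : Pq_scale a (Pq_scale b u) = Pq_scale (a * b) u.
Proof. by rewrite /Pq_scale Pq_cstM Pq_mulA. Qed.
Fact Pq_scale1 : left_id 1 Pq_scale.
Proof. exact: Pq_mul1l. Qed.
Fact Pq_scaleDr : right_distributive Pq_scale +%R.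
Proof. by move=> a u v; apply: Pq_mulDr. Qed.
Fact Pq_scaleDl (u : P) : {morph Pq_scale^~ u : a b / a + b}.
Proof. by move=> a b; rewrite /Pq_scale Pq_cstD; apply: Pq_mulDl. Qed.

HB.instance Definition _ :=
  GRing.Zmodule_isLmodule.Build K P Pq_scaleA Pq_scale1 Pq_scaleDr Pq_scaleDl.

Fact Pq_scaleAl a (u v : P) : a *: (u * v) = (a *: u) * v.
Proof. exact: Pq_mulA. Qed.
HB.instance Definition _ := GRing.Lmodule_isLalgebra.Build K P Pq_scaleAl.

Fact Pq_scaleAr a (u v : P) : a *: (u * v) = u * (a *: v).
Proof.
change (Pq_mul (Pq_cst a) (Pq_mul u v) = Pq_mul u (Pq_mul (Pq_cst a) v)).
by rewrite !Pq_mulA (Pq_cstC a u).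
Qed.
HB.instance Definition _ := GRing.Lalgebra_isAlgebra.Build K P Pq_scaleAr.

Lemma piD x y : \pi_P (TAdd x y) = \pi_P x + \pi_P y.
Proof. by symmetry; apply: Pq_addE. Qed.
Lemma piM x y : \pi_P (TMul x y) = \pi_P x * \pi_P y.
Proof. by symmetry; apply: Pq_mulE. Qed.
Lemma piC a : \pi_P (TCst a) = a%:A.
Proof. by symmetry; apply: Pq_mul1r. Qed.

Definition Zg (al : 'I_n) (j : 'I_r) : P := Pq_gen (GZ al j).
Definition Rg (al : 'I_n) : P := Pq_gen (GR al).
Definition Rginv (al : 'I_n) : P := Pq_gen (GRinv al).
Definition Cg (j : 'I_r) : P := Pq_gen (GC j).
Definition Cginv (j : 'I_r) : P := Pq_gen (GCinv j).

(* u ^ e, where v is the inverse of u *)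
Definition zpow (u v : P) (e : int) : P :=
  match e with Posz m => u ^+ m | Negz m => v ^+ m.+1 end.

Definition Rmon (e : 'I_n -> int) : P :=
  \prod_(be < n) zpow (Rg be) (Rginv be) (e be).
Definition Cmon (e : 'I_r -> int) : P :=
  \prod_(i < r) zpow (Cg i) (Cginv i) (e i).

End Algebra.

Arguments Pq_gen {K n r} q g.
Arguments Zg {K n r} q al j.
Arguments Rg {K n r} q al.
Arguments Rginv {K n r} q al.
Arguments Cg {K n r} q j.
Arguments Cginv {K n r} q j.
Arguments Rmon {K n r} q e.
Arguments Cmon {K n r} q e.

(* Exponents of the four Laurent monomials whose product is M_{alpha j}. *)
Record mondata (n r : nat) := MonData {
  rowexp  : 'M[int]_(n, n);   (* exponent of R_beta in \mathcal R_alpha  *)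
  rowexp' : 'M[int]_(r, n);   (* exponent of R_beta in \mathcal R'_j     *)
  colexp  : 'M[int]_(n, r);   (* exponent of C_i    in \mathcal C_alpha  *)
  colexp' : 'M[int]_(r, r)    (* exponent of C_i    in \mathcal C'_j     *)
}.

Section QuantumMinors.
Variables (K : fieldType) (n r : nat) (q : K).

Definition Mmon (D : mondata n r) (al : 'I_n) (j : 'I_r) : Pq n r q :=
  Rmon q (rowexp D al) * Rmon q (rowexp' D j) *
  Cmon q (colexp D al) * Cmon q (colexp' D j).

Definition perm_length m (s : 'S_m) : nat :=
  #|[set p : 'I_m * 'I_m | (p.1 < p.2)%N && (s p.2 < s p.1)%N]|.

(* A and J list the rows and the columns in increasing order. *)
Definition qminor m (A : 'I_m -> 'I_n) (J : 'I_m -> 'I_r) : Pq n r q :=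
  \sum_(s : 'S_m)
    (- q) ^+ perm_length s *: \prod_(i < m) Zg q (A i) (J (s i)).

Definition chi_minor (D : mondata n r) (a : int) m
    (A : 'I_m -> 'I_n) (J : 'I_m -> 'I_r) : Pq n r q :=
  q ^ a *: (qminor A J * \prod_(i < m) Mmon D (A i) (J i)).

End QuantumMinors.

Arguments Mmon {K n r} q D al j.
Arguments qminor {K n r} q {m} A J.
Arguments chi_minor {K n r} q D a {m} A J.

(* The rows and columns of chi_{alpha j}. The two cases alpha >= j and         *)
(* alpha < j are handled uniformly: both consist of the last min(alpha, j)     *)
(* rows up to alpha and of the last min(alpha, j) columns up to j (1-based).   *)
Lemma subn_minl_lt n r (al : 'I_n) (j : 'I_r) (i : 'I_(minn al j).+1) :
  (al - minn al j + i < n)%N.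
Proof.
apply: leq_ltn_trans (ltn_ord al).
by rewrite -[leqRHS](subnK (geq_minl al j)) leq_add2l -ltnS.
Qed.

Lemma subn_minr_lt n r (al : 'I_n) (j : 'I_r) (i : 'I_(minn al j).+1) :
  (j - minn al j + i < r)%N.
Proof.
apply: leq_ltn_trans (ltn_ord j).
by rewrite -[leqRHS](subnK (geq_minr al j)) leq_add2l -ltnS.
Qed.

Definition chi_row n r (al : 'I_n) (j : 'I_r) (i : 'I_(minn al j).+1) : 'I_n :=
  Ordinal (subn_minl_lt i).
Definition chi_col n r (al : 'I_n) (j : 'I_r) (i : 'I_(minn al j).+1) : 'I_r :=
  Ordinal (subn_minr_lt i).

Definition chi (K : fieldType) n r (q : K) (D : mondata n r) (a : int)
    (al : 'I_n) (j : 'I_r) : Pq n r q :=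
  chi_minor q D a (@chi_row n r al j) (@chi_col n r al j).

(* The bar anti-automorphism. Since q is a dummy parameter, an element given   *)
(* by an expression in q is a family of elements of P_q, one for every value   *)
(* of q. At a given value, fixing the generators, reversing products and       *)
(* sending q to q^-1 is the K-linear anti-isomorphism P_q -> P_{q^-1} that      *)
(* fixes the generators, and an expression f(q) is bar-invariant when          *)
(* bar (f(q)) = f(q^-1).                                                       *)
Fixpoint term_rev (K : Type) n r (x : term K n r) : term K n r :=
  match x with
  | TAdd x y => TAdd (term_rev x) (term_rev y)
  | TMul x y => TMul (term_rev y) (term_rev x)
  | _ => x
  end.

Definition bar (K : fieldType) n r (q : K) (u : Pq n r q) : Pq n r q^-1 :=
  \pi_(Pq n r q^-1) (term_rev (repr u)).

Section BarTheory.
Variables (K : fieldType) (n r : nat) (q : K).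
Hypothesis q0 : q != 0.

Lemma prelE (p : K) (x y : term K n r) :
  prel p x y -> \pi_(Pq n r p) x = \pi_(Pq n r p) y.
Proof. by move=> xy; apply/Pq_eqP; apply: pc_rel. Qed.

Lemma term_rev_rel (x y : term K n r) :
  prel q x y -> pcong q^-1 (term_rev x) (term_rev y).
Proof.
have flip (c : K) (u v : Pq n r q^-1) : c != 0 ->
    u * v = c^-1%:A * (v * u) -> v * u = (u * v) * c%:A.
  by move=> c0 ->; rewrite mulr_algl mulr_algr scalerA mulfV // scale1r.
have flipX (b : bool) (u v : Pq n r q^-1) :
    u * v = (q^-1 ^+ b)%:A * (v * u) -> v * u = (u * v) * (q ^+ b)%:A.
  by rewrite exprVn; apply: flip; apply: expf_neq0.
case=> [al j k h|al be j h|al be j l h h'|al be j l h h'|al be i|j i al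
       |al be|i j|al j|al|al|j|j]; apply/Pq_eqP; rewrite /= ?piD ?piM ?piC.
- by apply: flip => //; rewrite -piC -!piM; apply/prelE/prel_row.
- by apply: flip => //; rewrite -piC -!piM; apply/prelE/prel_col.
- by symmetry; rewrite -!piM; apply/prelE/prel_anti.
- have := prelE (prel_diag q^-1 h h'); rewrite ?piD ?piM ?piC => ->.
  have := prelE (prel_anti q^-1 h h'); rewrite ?piD ?piM => ->.
  rewrite invrK mulr_algl mulr_algr -addrA -scalerDl.
  by rewrite addrA subrK subrr scale0r addr0.
- by apply: flipX; rewrite -piC -!piM; apply/prelE/prel_RZ.
- by apply: flipX; rewrite -piC -!piM; apply/prelE/prel_CZ.
- by rewrite -!piM; apply/prelE/prel_RR.
- by rewrite -!piM; apply/prelE/prel_CC.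
- by symmetry; rewrite -!piM; apply/prelE/prel_RC.
- by rewrite -!piM -piC; apply/prelE/prel_VR.
- by rewrite -!piM -piC; apply/prelE/prel_RV.
- by rewrite -!piM -piC; apply/prelE/prel_VC.
- by rewrite -!piM -piC; apply/prelE/prel_CV.
Qed.

Lemma term_rev_cong (x y : term K n r) :
  pcong q x y -> pcong q^-1 (term_rev x) (term_rev y).
Proof.
elim=> {x y} /=.
- exact: term_rev_rel.
- by move=> x; apply: pc_refl.
- by move=> x y _; apply: pc_sym.
- by move=> x y z _ xy _; apply: pc_trans.
- by move=> x x' y y' _ xx _; apply: pc_add.
- by move=> x x' y y' _ xx _ yy; apply: pc_mul.
- by move=> *; apply: pc_addA.
- by move=> *; apply: pc_addC.
- by move=> *; apply: pc_add0.
- by move=> x; apply/Pq_eqP; rewrite !(piD, piM, piC) mulr_algr scaleN1r addNr scale0r.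
- by move=> x y z; apply/pc_sym/pc_mulA.
- by move=> *; apply: pc_mul1r.
- by move=> *; apply: pc_mul1l.
- by move=> *; apply: pc_mulDr.
- by move=> *; apply: pc_mulDl.
- by move=> *; apply: pc_cstD.
- by move=> a b; apply/Pq_eqP; rewrite !(piM, piC) mulr_algl scalerA mulrC.
- by move=> *; apply/pc_sym/pc_cstC.
Qed.

Lemma bar_pi (x : term K n r) :
  bar (\pi_(Pq n r q) x) = \pi_(Pq n r q^-1) (term_rev x).
Proof. by apply/Pq_eqP/term_rev_cong/Pq_repr. Qed.

Lemma barD (u v : Pq n r q) : bar (u + v) = bar u + bar v.
Proof. by rewrite -[u]reprK -[v]reprK -piD !bar_pi -piD. Qed.

Lemma barM (u v : Pq n r q) : bar (u * v) = bar v * bar u.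
Proof. by rewrite -[u]reprK -[v]reprK -piM !bar_pi -piM. Qed.

Lemma barZ (a : K) (u : Pq n r q) : bar (a *: u) = a *: bar u.
Proof.
by rewrite -mulr_algl barM -[in LHS](piC _ _ _ a) bar_pi /= piC mulr_algr.
Qed.

Lemma bar_gen (g : gen n r) : bar (Pq_gen q g) = Pq_gen q^-1 g.
Proof. exact: bar_pi. Qed.

End BarTheory.

Definition bar_invariant_exponent (K : fieldType) n r (q : K)
    (D : mondata n r) (al : 'I_n) (j : 'I_r) (a : int) : Prop :=
  bar (chi q D a al j) = chi q^-1 D a al j.

(* The exponent in chi_{alpha j} is one that makes it bar-invariant. For some  *)
(* admissible monomials no integer does: for n = r = 2, if M_{1j} = R_2 and    *)
(* M_{2j} = 1 then chi_{22} would need a = 1/2. In that case nothing is        *)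
(* required of a: q^a is then just some power of q.                            *)
Definition bar_normalized (K : fieldType) n r (q : K)
    (D : mondata n r) (a : 'M[int]_(n, r)) : Prop :=
  forall (al : 'I_n) (j : 'I_r),
    (exists b, bar_invariant_exponent q D al j b) ->
    bar_invariant_exponent q D al j (a al j).

(* nr x nr matrices have index type 'I_(n * r); the pair (alpha, j) has the    *)
(* index mxvec_index alpha j, whose value alpha * r + j gives the              *)
(* lexicographic order.                                                        *)
Definition pair_of n r (x : 'I_(n * r)) : 'I_n * 'I_r :=
  enum_val (cast_ord (esym (mxvec_cast n r)) x).

Lemma mxvec_indexK n r (al : 'I_n) (j : 'I_r) :
  pair_of (mxvec_index al j) = (al, j).
Proof. by rewrite /pair_of /mxvec_index cast_ordK enum_rankK. Qed.

Lemma nth_pairs (S T : Type) (x0 : S) (y0 : T) s t i j :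
  (i < size s)%N -> (j < size t)%N ->
  nth (x0, y0) [seq (x, y) | x <- s, y <- t] (i * size t + j) =
    (nth x0 s i, nth y0 t j).
Proof.
elim: s i => [|x s IH] [|i] //= hi hj; rewrite nth_cat size_map.
- by rewrite hj (nth_map y0).
- by rewrite mulSn -addnA ltnNge leq_addr /= addKn; apply: IH.
Qed.

Lemma mxvec_indexE n r (al : 'I_n) (j : 'I_r) :
  mxvec_index al j = (al * r + j)%N :> nat.
Proof.
have enumE : enum {: 'I_n * 'I_r} =
    [seq (x, y) | x <- enum 'I_n, y <- enum 'I_r].
  by rewrite enumT unlock.
have lt : (al * r + j < size (enum {: 'I_n * 'I_r}))%N.
  rewrite -cardE card_prod !card_ord (leq_trans (n := (al.+1 * r)%N)) //.
    by rewrite mulSn [(r + _)%N]addnC ltn_add2l.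
  by rewrite leq_mul2r ltn_ord orbT.
apply/eqP; rewrite /mxvec_index /=.
rewrite -(nth_uniq (al, j) _ lt (enum_uniq _)); last first.
  by rewrite -cardE ltn_ord.
have := nth_pairs al j (s := enum 'I_n) (t := enum 'I_r) (i := al) (j := j).
rewrite nth_enum_rank enumE !size_enum_ord !nth_ord_enum => -> //.
Qed.

Definition pair_mx n r (F : 'I_n -> 'I_r -> 'I_n -> 'I_r -> int) :
    'M[int]_(n * r) :=
  \matrix_(x, y) F (pair_of x).1 (pair_of x).2 (pair_of y).1 (pair_of y).2.

Definition hcoef n r (al : 'I_n) (j : 'I_r) (be : 'I_n) (k : 'I_r) : int :=
  if al == be then (j < k)%N%:Z - (k < j)%N%:Z
  else if j == k then (al < be)%N%:Z - (be < al)%N%:Z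
  else 0.

(* Phi al j be i stands for Phi_{alpha j}^{beta i}. *)
Definition Hmx n r (Phi : 'I_n -> 'I_r -> 'I_n -> 'I_r -> int) :
    'M[int]_(n * r) :=
  pair_mx (fun al j be k => hcoef al j be k + Phi al j be k - Phi be k al j).

Definition Tmx n r : 'M[int]_(n * r) :=
  pair_mx (fun (be : 'I_n) (k : 'I_r) (al : 'I_n) (j : 'I_r) =>
    if [exists x : 'I_(minn al j).+1,
          (be == al - x :> nat)%N && (k == j - x :> nat)%N]
    then 1 else 0).

(* Main.v *)
Require Import Defs.
From HB Require Import structures.
From mathcomp Require Import all_boot all_order all_algebra.
From mathcomp Require Import all_fingroup generic_quotient.
From mathcomp Require Import boolp functions reals complex.
From mathcomp Require Import zify ring.
Set Implicit Arguments.
Unset Strict Implicit.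
Unset Printing Implicit Defensive.
Import Order.TTheory GRing.Theory Num.Theory.
Local Open Scope ring_scope.

(* That the minors q-commute is given, so it suffices to find, for any two   *)
(* of them, a representation of P_q in which both are products of            *)
(* generators of a quantum torus. Say the minors lie on the diagonals        *)
(* j - al = d and j - al = d + g with g >= 0. Send Z to the product of a     *)
(* diagonal matrix, g bidiagonal quantum matrices and a diagonal matrix,     *)
(* with independent entries: Z_{al j} becomes a sum over lattice paths of g  *)
(* steps, each moving by 0 or 1, and vanishes unless d <= j - al <= d + g.   *)
(* As a permutation s with s i >= i for all i, or with s i <= i for all i,   *)
(* is the identity, each of the two minors reduces to its diagonal term,     *)
(* whose factors are paths that never move, respectively always move. The    *)
(* q-exponent of two such paths is the entry of h, and Phi accounts for the  *)
(* monomials M.                                                              *)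

(** * Quantum matrices *)

(** The column of T at (al, j) is the indicator of the diagonal positions of the minor chi_{al j},
    so T^t H T adds up H over pairs of diagonal positions ([Tmx_congr]). The claim is therefore that
    two minors q-commute exactly as the products of their diagonal terms do, as if the other
    permutations were absent.

    The factor in a relation x y = c y x survives any algebra morphism, and it can be read off from
    the image as soon as the image of y x is left regular ([qcomm_uniq]). No faithful representation
    is needed: for each pair of minors one is built in which both collapse to their diagonal terms.
    Multiplying a quantum matrix by a bidiagonal one preserves the relations
    ([bidiag_quantum_matrix], [pathmx_quantum]); the resulting band matrix, realized by shift and
    multiplication operators, satisfies all relations of P_q ([path_gen_rel]) and so defines a
    morphism ([Pq_universal]). The two minors lie on the two edges of the band, where entries are
    regular monomials with exponent h ([path_Z_qcomm]). [chi_qexponent] assembles this for one order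
    of the two diagonals; skew-symmetry gives the other. *)

Section QCommutation.
Variables (K : fieldType) (q : K) (A : algType K).
Hypothesis q0 : q != 0.
Implicit Types (x y z : A) (e f : int).

Definition qcomm e x y := x * y = q ^ e *: (y * x).

Lemma qcomm_sym e x y : qcomm e x y -> qcomm (- e) y x.
Proof. by rewrite /qcomm => ->; rewrite scalerA -expfzDr // addNr scale1r. Qed.

Lemma qcomm_comm x y : GRing.comm x y -> qcomm 0 x y.
Proof. by rewrite /qcomm scale1r. Qed.

Lemma commr_qcomm x y : qcomm 0 x y -> GRing.comm x y.
Proof. by rewrite /qcomm scale1r. Qed.

Lemma qcommDr e x y z : qcomm e x y -> qcomm e x z -> qcomm e x (y + z).
Proof. by rewrite /qcomm mulrDr mulrDl scalerDr => -> ->. Qed.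

Lemma qcommMl e f x y z : qcomm e x z -> qcomm f y z -> qcomm (e + f) (x * y) z.
Proof.
rewrite /qcomm => xz yz; rewrite -mulrA yz -scalerAr (mulrA x) xz.
by rewrite -scalerAl scalerA -expfzDr // addrC mulrA.
Qed.

Lemma qcommMr e f x y z : qcomm e x y -> qcomm f x z -> qcomm (e + f) x (y * z).
Proof.
move=> /qcomm_sym xy /qcomm_sym xz.
by rewrite -[e + f]opprK opprD; apply/qcomm_sym/qcommMl.
Qed.

Lemma qcomm_prodl (I : Type) (s : seq I) (e : I -> int) (F : I -> A) z :
  (forall i, qcomm (e i) (F i) z) ->
  qcomm (\sum_(i <- s) e i) (\prod_(i <- s) F i) z.
Proof.
move=> Fz; apply: (big_ind2 (fun f x => qcomm f x z)) => //.
- exact/qcomm_comm/commr_sym/commr1.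
- by move=> *; apply: qcommMl.
Qed.

Lemma qcomm_prodr (I : Type) (s : seq I) (e : I -> int) (F : I -> A) x :
  (forall i, qcomm (e i) x (F i)) ->
  qcomm (\sum_(i <- s) e i) x (\prod_(i <- s) F i).
Proof.
move=> Fz; apply: (big_ind2 (fun f y => qcomm f x y)) => //.
- exact/qcomm_comm/commr1.
- by move=> *; apply: qcommMr.
Qed.

Lemma qcommZ e a b x y : qcomm e x y -> qcomm e (a *: x) (b *: y).
Proof.
rewrite /qcomm => xy.
by rewrite -!scalerAl -!scalerAr xy !scalerA; congr (_ *: _); ring.
Qed.

(** Left regularity makes [y * x] nonzero, and over a field a nonzero vector determines its scalar
    factor. *)
Lemma qcomm_uniq (c : K) e x y :
  GRing.lreg (y * x) -> qcomm e x y -> x * y = c *: (y * x) -> c = q ^ e.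
Proof.
move=> yx -> /eqP; rewrite eq_sym -subr_eq0 -scalerBl scaler_eq0 subr_eq0.
by rewrite (negbTE (lreg_neq0 yx)) orbF => /eqP.
Qed.

End QCommutation.

(** * Products of quantum matrices with bidiagonal ones *)

Section QuantumMatrices.
Variables (K : fieldType) (q : K) (A : algType K) (n : nat).
Hypothesis q0 : q != 0.

Definition quantum_matrix (X : 'I_n -> int -> A) : Prop :=
  [/\ (forall al (x y : int), x < y ->
         X al x * X al y = q *: (X al y * X al x)),
      (forall (al be : 'I_n) x, (al < be)%N ->
         X al x * X be x = q *: (X be x * X al x)),
      (forall (al be : 'I_n) (x y : int), (be < al)%N -> x < y ->
         X al x * X be y = X be y * X al x) &
      (forall (al be : 'I_n) (x y : int), (al < be)%N -> x < y ->
         X al x * X be y =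
           X be y * X al x + (q - q^-1) *: (X al y * X be x))].

Variables (p s : int -> A).
Hypothesis pp : forall x y, GRing.comm (p x) (p y).
Hypothesis ss : forall x y, GRing.comm (s x) (s y).
Hypothesis ps : forall x y, y != x -> y != x + 1 -> GRing.comm (p x) (s y).
Hypothesis psS : forall x, p x * s (x + 1) = q *: (s (x + 1) * p x).
Hypothesis sp : forall x, s x * p x = q *: (p x * s x).

(** An instance of the coproduct of quantum matrices: the right factor has [p x] at (x, x) and [s x]
    at (x - 1, x), and its entries commute with those of [X]. The delicate terms are those with
    [y = x + 1], where two entries of [X] meet in the same column. *)
Lemma bidiag_quantum_matrix (X : 'I_n -> int -> A) :
  (forall al x y, GRing.comm (X al x) (p y)) ->
  (forall al x y, GRing.comm (X al x) (s y)) ->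
  quantum_matrix X ->
  quantum_matrix (fun al x => X al x * p x + X al (x - 1) * s x).
Proof.
move=> Xp Xs [Xrow Xcol Xanti Xdiag].
have mulX al be x y u v : GRing.comm (X be y) u ->
    (X al x * u) * (X be y * v) = (X al x * X be y) * (u * v).
  by move=> com; rewrite -!mulrA; congr (_ * _); rewrite !mulrA com.
have expand al be x y :
    (X al x * p x + X al (x - 1) * s x) * (X be y * p y + X be (y - 1) * s y)
    = (X al x * X be y * (p x * p y) + X al x * X be (y - 1) * (p x * s y))
    + (X al (x - 1) * X be y * (s x * p y)
      + X al (x - 1) * X be (y - 1) * (s x * s y)).
  by rewrite mulrDl !mulrDr !mulX.
have lt1 (x y : int) : x < y -> x - 1 < y - 1 by lia.
have pys (x y : int) : x < y -> p y * s x = s x * p y.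
  by move=> ?; apply: ps; lia.
have lt2 (x y : int) : x < y -> x - 1 < y by lia.
have lt0 (x : int) : x - 1 < x by lia.
have skew (x y : int) : x < y -> y != x + 1 -> x < y - 1 by lia.
have pxs (x y : int) : x < y -> y != x + 1 -> p x * s y = s y * p x.
  by move=> ? ?; apply: ps; lia.
split=> [al x y xy|al be x ab|al be x y ba xy|al be x y ab xy]; rewrite !expand.
- have -> : X al x * X al (y - 1) * (p x * s y) =
      q *: (X al (y - 1) * X al x * (s y * p x)).
    have [->|yx] := eqVneq y (x + 1); first by rewrite addrK psS -scalerAr.
    by rewrite Xrow ?pxs -?scalerAl //; apply: skew.
  rewrite (Xrow al x y) // (Xrow al (x - 1) y) ?lt2 //.
  rewrite (Xrow al (x - 1) (y - 1)) ?lt1 // (pp x y) (ss x y) -(pys x y) //.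
  by rewrite -!scalerAl -!scalerDr addrACA.
- rewrite (Xcol al be x) // (Xcol al be (x - 1)) // -!scalerAl.
  rewrite -(Xanti be al (x - 1)) //.
  rewrite (Xdiag al be (x - 1) x) // -(Xanti be al (x - 1) x) // sp.
  rewrite mulrDl -!scalerAr -!scalerAl !scalerDr !scalerA.
  set B := (X in q * (q - q^-1) *: X); set C := X be x * X al (x - 1) * _.
  (* On the right [B] has coefficient q^2; on the left it has 1 from its own product and q (q -
     q^-1) from the extra term of the diagonal relation. *)
  have -> : (q * q) *: B = B + (q * (q - q^-1)) *: B.
    by rewrite -[X in _ = X + _]scale1r -scalerDl; congr (_ *: _); field.
  rewrite -!addrA; congr (_ + _); rewrite addrCA; congr (_ + _).
- have -> : X al x * X be (y - 1) * (p x * s y) =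
      X be (y - 1) * X al x * (s y * p x).
    have [->|yx] := eqVneq y (x + 1).
      by rewrite addrK psS (Xcol be al) // -scalerAl -scalerAr.
    by rewrite Xanti ?pxs //; apply: skew.
  rewrite (Xanti al be x y) // (Xanti al be (x - 1) y) ?lt2 //.
  rewrite (Xanti al be (x - 1) (y - 1)) ?lt1 // (pp x y) (ss x y).
  by rewrite -(pys x y) // addrACA.
- set c := q - q^-1.
  have -> : X al x * X be (y - 1) * (p x * s y) =
      X be (y - 1) * X al x * (s y * p x)
      + c *: (X al (y - 1) * X be x * (s y * p x)).
    have [->|yx] := eqVneq y (x + 1).
      (* Both entries of [X] lie in column [x]; the column relation and [psS] give q^2, which equals
         1 + (q - q^-1) q. *)
      rewrite addrK psS (Xcol al be) // -!scalerAl -scalerAr !scalerA.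
      rewrite -[X in _ = X + _]scale1r -scalerDl; congr (_ *: _).
      by rewrite /c; field.
    by rewrite Xdiag ?pxs ?mulrDl -?scalerAl //; apply: skew.
  rewrite (Xdiag al be x y) // (Xdiag al be (x - 1) y) ?lt2 //.
  rewrite (Xdiag al be (x - 1) (y - 1)) ?lt1 //.
  rewrite (pp x y) (ss x y) -(pys x y) // !mulrDl -!scalerAl.
  rewrite [X in X + _ = _]addrACA -scalerDr.
  rewrite [X in _ + X = _]addrACA -scalerDr addrACA -scalerDr.
  by rewrite addrACA; congr (_ + c *: _); rewrite addrACA.
Qed.
End QuantumMatrices.

Lemma lreg_prod (R : pzRingType) (I : Type) (s : seq I) (F : I -> R) :
  (forall i, GRing.lreg (F i)) -> GRing.lreg (\prod_(i <- s) F i).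
Proof.
move=> regF; apply: (big_ind (fun x : R => GRing.lreg x)) => //.
- exact: lreg1.
- by move=> *; apply: lregM.
Qed.

(** * Band matrices as sums over lattice paths *)

Section PathMatrix.
Variables (K : fieldType) (A : algType K) (n : nat).
Variables (z : 'I_n -> A) (p s : nat -> int -> A).
(* The sum over lattice paths from row [al] to column [x] in [g] steps, each   *)
(* of which stays in place or moves one column to the right: the product of    *)
(* the diagonal matrix [z] with [g] bidiagonal matrices.                       *)
Fixpoint pathmx (g : nat) (al : 'I_n) (x : int) : A :=
  if g is t.+1 then pathmx t al x * p t x + pathmx t al (x - 1) * s t x
  else if x == al%:Z then z al else 0.

(** No path moves left. Columns are integers, so [x - 1] is never truncated. *)
Lemma pathmx_small g (al : 'I_n) x : x < al%:Z -> pathmx g al x = 0.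
Proof.
elim: g x => [|g IH] x ltx /=; first by case: eqP => //; lia.
by rewrite !IH ?mul0r ?addr0 //; lia.
Qed.

Lemma pathmx_large g (al : 'I_n) x : al%:Z + g%:Z < x -> pathmx g al x = 0.
Proof.
elim: g x => [|g IH] x ltx /=; first by case: eqP => //; lia.
by rewrite !IH ?mul0r ?addr0 //; lia.
Qed.

(** Only the path that stays in place at every step ends in its starting column. *)
Lemma pathmx_first g al : pathmx g al al%:Z = z al * \prod_(t < g) p t al%:Z.
Proof.
elim: g => [|g IH] /=; first by rewrite eqxx big_ord0 mulr1.
rewrite (pathmx_small g (x := al%:Z - 1)) ?IH; last by lia.
by rewrite mul0r addr0 big_ord_recr mulrA.
Qed.

(** Only the path that moves at every step gets this far; its step [t] arrives in column al + t +
    1. *)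
Lemma pathmx_last g al :
  pathmx g al (al + g)%N = z al * \prod_(t < g) s t (al + t).+1%:Z.
Proof.
elim: g => [|g IH] /=; first by rewrite addn0 eqxx big_ord0 mulr1.
rewrite pathmx_large ?big_ord_recr ?mul0r ?add0r ?mulrA /=; last by lia.
by rewrite -IH addnS; congr (pathmx _ _ _ * _); lia.
Qed.

Variable q : K.
Hypothesis q0 : q != 0.
Hypothesis zz : forall al be, GRing.comm (z al) (z be).
Hypothesis zp : forall al t x, GRing.comm (z al) (p t x).
Hypothesis zs : forall al t x, GRing.comm (z al) (s t x).
Hypothesis pp : forall t x u y, GRing.comm (p t x) (p u y).
Hypothesis ss : forall t x u y, GRing.comm (s t x) (s u y).
Hypothesis ps : forall t x u y,
  qcomm q (((t == u) && (y == x + 1))%:Z - ((t == u) && (y == x))%:Z)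
    (p t x) (s u y).

(** Every path from row [al] contains exactly one factor [z al], which alone carries the weight.
    Only steps below [g] are constrained, so that [y] may itself be a factor of step [g]. *)
Lemma pathmx_qcomml e g al x y :
  qcomm q e y (z al) ->
  (forall t u, (t < g)%N -> GRing.comm y (p t u)) ->
  (forall t u, (t < g)%N -> GRing.comm y (s t u)) ->
  qcomm q e y (pathmx g al x).
Proof.
move=> yz; elim: g x => [|g IH] x yp ys /=.
  by case: ifP => _ //; rewrite /qcomm mulr0 mul0r scaler0.
have IHg u : qcomm q e y (pathmx g al u).
  by apply: IH => t ? ?; [apply: yp|apply: ys]; apply: ltnW.
by apply: qcommDr; rewrite -[e]addr0; apply: qcommMr => //; apply: qcomm_comm;
  [apply: yp|apply: ys].
Qed.

Lemma path_ps t x u y : (t == u) && (y == x + 1) = false ->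
  (t == u) && (y == x) = false -> GRing.comm (p t x) (s u y).
Proof. by move=> h1 h2; have := ps t x u y; rewrite h1 h2 /qcomm scale1r. Qed.

Lemma pathmx_quantum g : quantum_matrix q (pathmx g).
Proof.
elim: g => [|g IH] /=.
  split=> [al x y xy|al be x ab|al be x y ba xy|al be x y ab xy];
    do ![case: eqP => ?]; rewrite ?(mulr0, mul0r, scaler0, addr0) //;
    first [lia | exact: zz].
apply: bidiag_quantum_matrix => //.
- by move=> x y yx yx1; apply: path_ps; rewrite ?(negbTE yx) ?(negbTE yx1) andbF.
- by move=> x; have := ps g x g (x + 1); rewrite !eqxx /=; case: eqP; first lia.
- move=> x; have := qcomm_sym q0 (ps g x g x).
  by rewrite !eqxx /=; case: eqP; first lia.
- move=> al x y; apply/commr_sym/commr_qcomm/pathmx_qcomml => [|//|t u lt_tg].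
    exact/qcomm_comm/commr_sym.
  by apply: path_ps; case: eqP => //; lia.
- move=> al x y; apply/commr_sym/commr_qcomm/pathmx_qcomml => [|t u lt_tg|//].
    exact/qcomm_comm/commr_sym.
  by apply/commr_sym/path_ps; case: eqP => //; lia.
Qed.

Lemma pathmx_qcomm g (al be : 'I_n) :
  qcomm q ((al == be)%:Z - (al == be + g :> nat)%N%:Z)
    (pathmx g al al%:Z) (pathmx g be (be + g)%N).
Proof.
rewrite pathmx_first pathmx_last.
have -> : (al == be)%:Z - (al == be + g :> nat)%N%:Z =
    0 + 0 + (0 + \sum_(t < g) \sum_(u < g)
      (((t == u :> nat) && ((be + u).+1%:Z == al%:Z + 1))%:Z
       - ((t == u :> nat) && ((be + u).+1%:Z == al%:Z))%:Z)).
  (* Only factors of the same step interact, and for step [t] the contribution is [al = be + t] -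
     [al = be + t + 1], which telescopes over [t]. *)
  rewrite !add0r (eq_bigr (fun t : 'I_g =>
    - ((al == be + t.+1 :> nat)%N%:Z - (al == be + t :> nat)%N%:Z))); last first.
    move=> t _; rewrite (bigD1 t) //= big1 ?addr0.
      by rewrite eqxx /=; lia.
    by move=> u /negbTE ut; rewrite [(t : nat) == _]eq_sym val_eqE ut.
  rewrite sumrN -(big_mkord xpredT (fun t =>
    (al == be + t.+1 :> nat)%N%:Z - (al == be + t :> nat)%N%:Z)).
  by rewrite telescope_sumr // addn0 opprB.
apply: qcommMl => //; apply: qcommMr => //.
- exact: qcomm_comm.
- by apply/qcomm_comm/commr_prod.
- exact/qcomm_comm/commr_sym/commr_prod.
- by apply: qcomm_prodl => // t; apply: qcomm_prodr.
Qed.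

End PathMatrix.

(** * A quantum torus of operators on functions on a lattice *)

Section Endomorphisms.
Variables (K : fieldType) (S : Type).

(** Operators on functions of arbitrary support. Shifts and multiplications by powers of q generate
    a quantum torus there whose monomials are left regular, whether or not q is a root of unity. *)
Record endo := Endo {
  endo_fun :> (S -> K^o) -> (S -> K^o);
  endo_linear : linear endo_fun }.

HB.instance Definition _ := gen_eqMixin endo.
HB.instance Definition _ := gen_choiceMixin endo.

Implicit Types (x y : endo) (a b : K) (f : S -> K^o).

Lemma endoP x y : (forall f v, x f v = y f v) -> x = y.
Proof.
case: x => x xl; case: y => y yl /= xy.
have e : x = y by apply/funext => f; apply/funext => v.
by case: _ / e yl => yl; congr Endo; apply: Prop_irrelevance.
Qed.

Lemma endoD x f g : x (f + g) = x f + x g.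
Proof. by have := endo_linear x 1 f g; rewrite !scale1r. Qed.
Lemma endoZ x a f : x (a *: f) = a *: x f.
Proof.
have x0 : x 0 = 0 by apply: (addrI (x 0)); rewrite -endoD !addr0.
by have := endo_linear x a f 0; rewrite x0 !addr0.
Qed.

Lemma endo_zero_linear : linear (fun _ : S -> K^o => 0 : S -> K^o).
Proof. by move=> a f g; rewrite scaler0 addr0. Qed.
Lemma endo_id_linear : linear (id : (S -> K^o) -> (S -> K^o)).
Proof. by []. Qed.
Lemma endo_add_linear x y : linear (fun f => x f + y f).
Proof. by move=> a f g; rewrite !endoD !endoZ scalerDr addrACA. Qed.
Lemma endo_mul_linear x y : linear (fun f => x (y f)).
Proof. by move=> a f g; rewrite !(endoD, endoZ). Qed.
Lemma endo_scale_linear b x : linear (fun f => b *: x f).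
Proof.
by move=> a f g; rewrite !(endoD, endoZ) scalerDr !scalerA [b * a]mulrC.
Qed.

Definition endo_zero := Endo endo_zero_linear.
Definition endo_one := Endo endo_id_linear.
Definition endo_add x y := Endo (endo_add_linear x y).
Definition endo_scale a x := Endo (endo_scale_linear a x).
Definition endo_mul x y := Endo (endo_mul_linear x y).

Fact endo_addA : associative endo_add.
Proof. by move=> x y z; apply: endoP => f v /=; rewrite addrA. Qed.
Fact endo_addC : commutative endo_add.
Proof. by move=> x y; apply: endoP => f v /=; rewrite addrC. Qed.
Fact endo_add0 : left_id endo_zero endo_add.
Proof. by move=> x; apply: endoP => f v /=; rewrite add0r. Qed.
Fact endo_addN : left_inverse endo_zero (endo_scale (-1)) endo_add.
Proof. by move=> x; apply: endoP => f v /=; rewrite scaleN1r addNr. Qed.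
HB.instance Definition _ :=
  GRing.isZmodule.Build endo endo_addA endo_addC endo_add0 endo_addN.

End Endomorphisms.

Section EndomorphismRing.
Variables (K : fieldType) (I : Type).
Local Notation S := (I -> int).
Local Notation endo := (endo K S).

Fact endo_mulA : associative (@endo_mul K S).
Proof. by move=> x y z; apply: endoP. Qed.
Fact endo_mul1l : left_id (endo_one K S) (@endo_mul K S).
Proof. by move=> x; apply: endoP. Qed.
Fact endo_mul1r : right_id (endo_one K S) (@endo_mul K S).
Proof. by move=> x; apply: endoP. Qed.
Fact endo_mulDl : left_distributive (@endo_mul K S) +%R.
Proof. by move=> x y z; apply: endoP. Qed.
Fact endo_mulDr : right_distributive (@endo_mul K S) +%R.
Proof. by move=> x y z; apply: endoP => f v /=; rewrite endoD. Qed.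
Fact endo_nontrivial : endo_one K S != 0.
Proof.
apply/eqP => /(congr1 (fun x : endo => x (fun=> 1) (fun=> 0)))/eqP.
by rewrite /= oner_eq0.
Qed.
HB.instance Definition _ :=
  GRing.Zmodule_isNzRing.Build endo endo_mulA endo_mul1l endo_mul1r
    endo_mulDl endo_mulDr endo_nontrivial.

Fact endo_scaleA (a b : K) (x : endo) :
  endo_scale a (endo_scale b x) = endo_scale (a * b) x.
Proof. by apply: endoP => f v /=; rewrite scalerA. Qed.
Fact endo_scale1 : left_id 1 (@endo_scale K S).
Proof. by move=> x; apply: endoP => f v /=; rewrite scale1r. Qed.
Fact endo_scaleDr : right_distributive (@endo_scale K S) +%R.
Proof. by move=> a x y; apply: endoP => f v /=; rewrite scalerDr. Qed.
Fact endo_scaleDl (x : endo) : {morph (@endo_scale K S)^~ x : a b / a + b}.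
Proof. by move=> a b; apply: endoP => f v /=; rewrite scalerDl. Qed.
HB.instance Definition _ := GRing.Zmodule_isLmodule.Build K endo
  endo_scaleA endo_scale1 endo_scaleDr endo_scaleDl.

Fact endo_scaleAl (a : K) (x y : endo) : a *: (x * y) = (a *: x) * y.
Proof. exact: endoP. Qed.
HB.instance Definition _ := GRing.Lmodule_isLalgebra.Build K endo endo_scaleAl.
Fact endo_scaleAr (a : K) (x y : endo) : a *: (x * y) = x * (a *: y).
Proof. by apply: endoP => f v /=; rewrite endoZ. Qed.
HB.instance Definition _ := GRing.Lalgebra_isAlgebra.Build K endo endo_scaleAr.

End EndomorphismRing.

Section WeylAlgebra.
Variables (K : fieldType) (q : K) (I : eqType).
Hypothesis q0 : q != 0.
Local Notation A := (endo K (I -> int)).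
Implicit Types (i j : I) (v : I -> int) (f : (I -> int) -> K^o).

Definition unit_shift i v : I -> int := fun j => v j - (i == j)%:Z.

Lemma shift_linear i : linear (fun f v => f (unit_shift i v)).
Proof. by []. Qed.
Lemma diag_linear (c : (I -> int) -> K) :
  linear (fun f v => c v *: f v : K^o).
Proof.
move=> a f g; apply/funext => v.
by rewrite /= !fctE scalerDr !scalerA [c v * a]mulrC.
Qed.

Definition shift_op i : A := Endo (shift_linear i).
Definition diag_op i : A := Endo (diag_linear (fun v => q ^ v i)).
Definition diagV_op i : A := Endo (diag_linear (fun v => q ^ (- v i))).

Lemma shift_op_comm i j : GRing.comm (shift_op i) (shift_op j).
Proof.
apply: endoP => f v /=; congr (f _).
by apply/funext => k; rewrite /unit_shift addrAC.
Qed.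
Lemma diag_op_comm i j : GRing.comm (diag_op i) (diag_op j).
Proof. by apply: endoP => f v /=; rewrite !scalerA mulrC. Qed.
Lemma diag_diagV_comm i j : GRing.comm (diag_op i) (diagV_op j).
Proof. by apply: endoP => f v /=; rewrite !scalerA mulrC. Qed.
Lemma diagV_op_comm i j : GRing.comm (diagV_op i) (diagV_op j).
Proof. by apply: endoP => f v /=; rewrite !scalerA mulrC. Qed.
Lemma diag_opK i : diag_op i * diagV_op i = 1.
Proof.
by apply: endoP => f v /=; rewrite scalerA -expfzDr // subrr scale1r.
Qed.
Lemma diagV_opK i : diagV_op i * diag_op i = 1.
Proof. by rewrite -[LHS]diag_diagV_comm diag_opK. Qed.

Lemma diag_shift i j : qcomm q (i == j)%:Z (diag_op i) (shift_op j).
Proof.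
apply: endoP => f v /=; rewrite [RHS]scalerA -expfzDr // /unit_shift.
by rewrite [i == j]eq_sym addrC subrK.
Qed.
Lemma diagV_shift i j : qcomm q (- (i == j)%:Z) (diagV_op i) (shift_op j).
Proof.
apply: endoP => f v /=; rewrite [RHS]scalerA -expfzDr // /unit_shift.
by rewrite [i == j]eq_sym opprB addrA addNr add0r.
Qed.

Lemma shift_op_lreg i : GRing.lreg (shift_op i).
Proof.
move=> x y xy; apply: endoP => f v.
(* Evaluation at the translated point undoes the shift. *)
have /(congr1 (fun u : A => u f (fun j => v j + (i == j)%:Z))) := xy.
rewrite /= /unit_shift; congr (_ = _); congr (_ f _); apply/funext => j;
  by rewrite addrK.
Qed.
Lemma diag_op_lreg i : GRing.lreg (diag_op i).
Proof.
apply: (can_inj (g := fun x => diagV_op i * x)) => x.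
by rewrite mulrA diagV_opK mul1r.
Qed.
Lemma diagV_op_lreg i : GRing.lreg (diagV_op i).
Proof.
apply: (can_inj (g := fun x => diag_op i * x)) => x.
by rewrite mulrA diag_opK mul1r.
Qed.

End WeylAlgebra.

(** * Representations of P_q *)

Section Universal.
Variables (K : fieldType) (n r : nat) (q : K) (A : algType K).
Variable g : gen n r -> A.

Fixpoint term_eval (x : term K n r) : A :=
  match x with
  | TCst a => a%:A
  | TGen u => g u
  | TAdd x y => term_eval x + term_eval y
  | TMul x y => term_eval x * term_eval y
  end.

Hypothesis g_rel : forall x y, prel q x y -> term_eval x = term_eval y.

Lemma term_eval_cong x y : pcong q x y -> term_eval x = term_eval y.
Proof.
elim=> {x y} //=.
- by move=> x y z _ -> _ ->.
- by move=> x x' y y' _ -> _ ->.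
- by move=> x x' y y' _ -> _ ->.
- by move=> *; rewrite addrA.
- by move=> *; rewrite addrC.
- by move=> *; rewrite scale0r add0r.
- by move=> *; rewrite mulr_algl scaleN1r addNr scale0r.
- by move=> *; rewrite mulrA.
- by move=> *; rewrite scale1r mul1r.
- by move=> *; rewrite scale1r mulr1.
- by move=> *; rewrite mulrDl.
- by move=> *; rewrite mulrDr.
- by move=> *; rewrite scalerDl.
- by move=> *; rewrite mulr_algl scalerA.
- by move=> *; rewrite mulr_algl mulr_algr.
Qed.

(** The universal property of the presentation: evaluating a representative is well defined by
    [term_eval_cong]. *)
Lemma Pq_universal :
  exists ev : {lrmorphism Pq n r q -> A}, forall u, ev (Pq_gen q u) = g u.
Proof.
pose ev (u : Pq n r q) := term_eval (repr u).
have evE x : ev (\pi_(Pq n r q)%qT x) = term_eval x.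
  exact/term_eval_cong/Pq_repr.
have evZ : linear ev.
  move=> a u v; rewrite -mulr_algl -[a%:A](piC _ _ q) -[u]reprK -[v]reprK.
  by rewrite -piM -piD !evE /= mulr_algl.
have ev1 : ev 1 = 1 by rewrite -[X in ev X]scale1r -(piC n r q) evE /= scale1r.
have evM : {morph ev : u v / u * v}.
  by move=> u v; rewrite -[u]reprK -[v]reprK -piM !evE.
pose lin := GRing.isLinear.Build _ _ _ _ ev evZ.
pose mon := GRing.isMonoidMorphism.Build _ _ ev (conj ev1 evM).
pose ev' : {lrmorphism Pq n r q -> A} := HB.pack ev lin mon.
by exists ev' => u; apply: evE.
Qed.

End Universal.

Section Monomials.
Variables (K : fieldType) (n r : nat) (q : K) (D : mondata n r).

(** An induction principle for the monomials M, used for the regularity and the commutation of their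
    images. *)
Lemma Mmon_closed (Pr : Pq n r q -> Prop) al j :
  Pr 1 -> (forall u v, Pr u -> Pr v -> Pr (u * v)) ->
  (forall be, Pr (Rg q be)) -> (forall be, Pr (Rginv q be)) ->
  (forall i, Pr (Cg q i)) -> (forall i, Pr (Cginv q i)) ->
  Pr (Mmon q D al j).
Proof.
move=> P1 PM PR PRi PC PCi.
have PX u m : Pr u -> Pr (u ^+ m).
  by move=> Pu; elim: m => // m IH; rewrite exprS; apply: PM.
have PZ u v e : Pr u -> Pr v -> Pr (zpow u v e).
  by move=> Pu Pv; case: e => m; apply: PX.
have PRm e : Pr (Rmon q e).
  by apply: (big_ind (fun u => Pr u)) => // i _; apply: PZ.
have PCm e : Pr (Cmon q e).
  by apply: (big_ind (fun u => Pr u)) => // i _; apply: PZ.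
exact/PM/PCm/PM/PCm/PM.
Qed.
End Monomials.

(** * The lattice-path representation of P_q *)

Section PathRepresentation.
Variables (K : fieldType) (n r : nat) (q : K) (g : nat) (d : int).
Hypothesis q0 : q != 0.

Local Notation I := ('I_n + 'I_r + nat * int)%type.
Local Notation A := (endo K (I -> int)).
Local Notation T := (shift_op K).
Local Notation d_ := (@diag_op K q I).
Local Notation dV := (@diagV_op K q I).

Definition row_ix (al : 'I_n) : I := inl (inl al).
Definition col_ix (j : 'I_r) : I := inl (inr j).
Definition step_ix (t : nat) (x : int) : I := inr (t, x).

Definition path_z al : A := T (row_ix al).
Definition path_p t x : A := T (step_ix t x).
(* q-commutes with the shifts at (t, x) and (t, x - 1) and with no other one. *)
Definition path_s t x : A := d_ (step_ix t x) * dV (step_ix t (x - 1)).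
Definition path_w j : A := T (col_ix j).
Local Notation X := (pathmx path_z path_p path_s g).

(** Subtracting [d] makes the diagonal j - al = d the left edge of the band. The row shift inside
    [X] carries the weight for R, the column shift [path_w j] the weight for C. *)
Definition path_gen (u : gen n r) : A :=
  match u with
  | GZ al j => X al (j%:Z - d) * path_w j
  | GR al => d_ (row_ix al)
  | GRinv al => dV (row_ix al)
  | GC j => d_ (col_ix j)
  | GCinv j => dV (col_ix j)
  end.

Lemma path_s_qcomm u y i :
  qcomm q ((step_ix u y == i)%:Z - (step_ix u (y - 1) == i)%:Z)
    (path_s u y) (T i).
Proof. by apply: qcommMl => //; [apply: diag_shift|apply: diagV_shift]. Qed.

Lemma path_ps_qcomm t x u y :
  qcomm q (((t == u) && (y == x + 1))%:Z - ((t == u) && (y == x))%:Z)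
    (path_p t x) (path_s u y).
Proof.
have := qcomm_sym q0 (path_s_qcomm u y (step_ix t x)).
have step_eq v : (step_ix u v == step_ix t x) = (t == u) && (v == x).
  by rewrite [t == u]eq_sym.
by rewrite opprB !step_eq subr_eq.
Qed.

Lemma path_s_comm t x u y : GRing.comm (path_s t x) (path_s u y).
Proof.
apply: commrM; apply/commr_sym/commrM.
- exact: diag_op_comm.
- exact: diag_diagV_comm.
- exact/commr_sym/diag_diagV_comm.
- exact: diagV_op_comm.
Qed.

Lemma path_s_comm_row al u y : GRing.comm (path_z al) (path_s u y).
Proof. exact/commr_sym/commr_qcomm/path_s_qcomm. Qed.
Lemma path_s_comm_col j u y : GRing.comm (path_w j) (path_s u y).
Proof. exact/commr_sym/commr_qcomm/path_s_qcomm. Qed.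

Lemma pathmx_comm_col al x j : GRing.comm (X al x) (path_w j).
Proof.
apply/commr_sym/(@commr_qcomm _ q)/pathmx_qcomml => // [|t u _|t u _].
- exact/qcomm_comm/shift_op_comm.
- exact: shift_op_comm.
- exact: path_s_comm_col.
Qed.

Lemma diag_op_qcomm_path i al j : (forall t x, i != step_ix t x) ->
  qcomm q ((i == row_ix al)%:Z + (i == col_ix j)%:Z)
    (d_ i) (path_gen (GZ al j)).
Proof.
move=> i_step; apply: qcommMr => //; last exact: diag_shift.
apply: pathmx_qcomml => // [|t u _|t u _]; first exact: diag_shift.
- apply: (@commr_qcomm _ q); have := diag_shift q0 i (step_ix t u).
  by rewrite (negbTE (i_step _ _)).
- by apply: commrM; [apply: diag_op_comm|apply: diag_diagV_comm].
Qed.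

Lemma path_gen_rel (x y : term K n r) :
  prel q x y -> term_eval path_gen x = term_eval path_gen y.
Proof.
have [Xrow Xcol Xanti Xdiag] : quantum_matrix q X.
  apply: pathmx_quantum => //; move=> *.
  - exact: shift_op_comm.
  - exact: shift_op_comm.
  - exact: path_s_comm_row.
  - exact: shift_op_comm.
  - exact: path_s_comm.
  - exact: path_ps_qcomm.
have mulXw al j be k x' y' :
    X al x' * path_w j * (X be y' * path_w k) =
    X al x' * X be y' * (path_w j * path_w k).
  rewrite -!mulrA; congr (_ * _); rewrite !mulrA; congr (_ * _).
  exact/commr_sym/pathmx_comm_col.
have ww j k : path_w j * path_w k = path_w k * path_w j by exact: shift_op_comm.
have qE (b : bool) (u : A) : (q ^+ b)%:A * u = q ^ b%:Z *: u.
  by rewrite mulr_algl.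
case=> {x y} /=.
- move=> al j k jk; rewrite !mulXw mulr_algl (ww k) Xrow ?scalerAl //; lia.
- by move=> al be j ab; rewrite !mulXw mulr_algl Xcol ?scalerAl.
- by move=> al be j l ba jl; rewrite !mulXw (ww l) Xanti //; lia.
- move=> al be j l ab jl; rewrite !mulXw mulr_algl (ww l) Xdiag; [|lia..].
  by rewrite mulrDl -scalerAl.
- move=> al be i; rewrite qE; have := @diag_op_qcomm_path (row_ix al) be i.
  by rewrite addr0; apply.
- move=> j i al; rewrite qE; have := @diag_op_qcomm_path (col_ix j) al i.
  by rewrite add0r; apply.
- by move=> *; apply: diag_op_comm.
- by move=> *; apply: diag_op_comm.
- by move=> *; apply: diag_op_comm.
- by move=> *; rewrite diag_opK // scale1r.
- by move=> *; rewrite diagV_opK // scale1r.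
- by move=> *; rewrite diag_opK // scale1r.
- by move=> *; rewrite diagV_opK // scale1r.
Qed.

End PathRepresentation.

Lemma lregZ (K : fieldType) (A : algType K) (c : K) (x : A) :
  c != 0 -> GRing.lreg x -> GRing.lreg (c *: x).
Proof. by move=> c0 xr y z; rewrite -!scalerAl => /(scalerI c0)/xr. Qed.

Lemma prodr_eq0 (R : pzRingType) (I : eqType) (s : seq I) (F : I -> R) i :
  i \in s -> F i = 0 -> \prod_(k <- s) F k = 0.
Proof.
move=> + Fi0; elim: s => //= k s IH; rewrite inE big_cons.
by case/predU1P => [<-|/IH ->]; rewrite ?Fi0 ?mul0r ?mulr0.
Qed.

Section PathImage.
Variables (K : fieldType) (n r : nat) (q : K) (g : nat) (d : int).
Local Notation I := ('I_n + 'I_r + nat * int)%type.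
Local Notation A := (endo K (I -> int)).
Variable ev : {lrmorphism Pq n r q -> A}.
Hypothesis evE : forall u, ev (Pq_gen q u) = path_gen q g d u.

Lemma path_Z_out (al : 'I_n) (j : 'I_r) :
  (j%:Z < al%:Z + d) || (al%:Z + d + g%:Z < j%:Z) -> ev (Zg q al j) = 0.
Proof.
rewrite evE /=; case/orP => jal.
  by rewrite pathmx_small ?mul0r //; lia.
by rewrite pathmx_large ?mul0r //; lia.
Qed.

Lemma path_Z_first (al : 'I_n) (j : 'I_r) : j%:Z = al%:Z + d ->
  ev (Zg q al j) =
    pathmx (path_z K r) (path_p K n r) (path_s n r q) g al al%:Z * path_w K n j.
Proof. by move=> e; rewrite evE /= e addrK. Qed.

Lemma path_Z_last (al : 'I_n) (j : 'I_r) : j%:Z = al%:Z + d + g%:Z ->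
  ev (Zg q al j) =
    pathmx (path_z K r) (path_p K n r) (path_s n r q) g al (al + g)%N *
    path_w K n j.
Proof. by move=> e; rewrite evE /= e; congr (pathmx _ _ _ _ _ _ * _); lia. Qed.

Hypothesis q0 : q != 0.

Lemma path_Z_first_lreg (al : 'I_n) (j : 'I_r) :
  j%:Z = al%:Z + d -> GRing.lreg (ev (Zg q al j)).
Proof.
move=> /path_Z_first ->; rewrite pathmx_first.
apply/lregM/shift_op_lreg/lregM/lreg_prod; first exact: shift_op_lreg.
by move=> t; apply: shift_op_lreg.
Qed.

Lemma path_Z_last_lreg (al : 'I_n) (j : 'I_r) :
  j%:Z = al%:Z + d + g%:Z -> GRing.lreg (ev (Zg q al j)).
Proof.
move=> /path_Z_last ->; rewrite pathmx_last.
apply/lregM/shift_op_lreg/lregM/lreg_prod; first exact: shift_op_lreg.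
by move=> t; apply: lregM; [apply: diag_op_lreg|apply: diagV_op_lreg].
Qed.

Lemma path_Z_qcomm (al be : 'I_n) (j k : 'I_r) :
  j%:Z = al%:Z + d -> k%:Z = be%:Z + d + g%:Z ->
  qcomm q (hcoef al j be k) (ev (Zg q al j)) (ev (Zg q be k)).
Proof.
move=> jal kbe; rewrite path_Z_first // path_Z_last //.
(* On these two diagonals [j = k] means [al = be + g], so h takes the value of the telescoped
   exponent. *)
have -> : hcoef al j be k =
    (al == be)%:Z - (al == be + g :> nat)%N%:Z + 0 + (0 + 0).
  rewrite /hcoef !addr0 -!val_eqE /=.
  move: (al : nat) (be : nat) (j : nat) (k : nat) jal kbe.
  by move=> u v x y; case: (u =P v); case: (x =P y); lia.
have Xw := pathmx_comm_col g q0.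
apply: qcommMl => //; apply: qcommMr => //.
- apply: pathmx_qcomm => //; move=> *.
  + exact: shift_op_comm.
  + exact: shift_op_comm.
  + exact: path_s_comm_row.
  + exact: path_ps_qcomm.
- exact/qcomm_comm/Xw.
- exact/qcomm_comm/commr_sym/Xw.
- exact/qcomm_comm/shift_op_comm.
Qed.

Lemma path_Mmon_lreg (D : mondata n r) al j : GRing.lreg (ev (Mmon q D al j)).
Proof.
apply: (@Mmon_closed K n r q D (fun u => GRing.lreg (ev u))).
- by rewrite rmorph1; apply: lreg1.
- by move=> u v; rewrite rmorphM; apply: lregM.
- by move=> be; rewrite evE; apply: diag_op_lreg.
- by move=> be; rewrite evE; apply: diagV_op_lreg.
- by move=> be; rewrite evE; apply: diag_op_lreg.
- by move=> be; rewrite evE; apply: diagV_op_lreg.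
Qed.

Lemma path_Mmon_comm (D : mondata n r) al j be k :
  GRing.comm (ev (Mmon q D al j)) (ev (Mmon q D be k)).
Proof.
have comM (x : A) al' j' : (forall i, GRing.comm x (diag_op q i)) ->
    (forall i, GRing.comm x (diagV_op q i)) ->
    GRing.comm x (ev (Mmon q D al' j')).
  move=> xd xdV; apply: (@Mmon_closed K n r q D (fun u => GRing.comm x (ev u))).
  - by rewrite rmorph1; apply: commr1.
  - by move=> u v; rewrite rmorphM; apply: commrM.
  - by move=> i; rewrite evE; apply: xd.
  - by move=> i; rewrite evE; apply: xdV.
  - by move=> i; rewrite evE; apply: xd.
  - by move=> i; rewrite evE; apply: xdV.
apply: (comM) => i; apply/commr_sym/comM => i'.
- exact: diag_op_comm.
- exact: diag_diagV_comm.
- exact/commr_sym/diag_diagV_comm.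
- exact: diagV_op_comm.
Qed.

End PathImage.

(** * Reduction of quantum minors to their diagonal terms *)

(** The values of [s] and the indices have the same sum, so termwise inequalities are equalities. *)
Lemma perm_ge_id m (s : 'S_m) : (forall i : 'I_m, (i <= s i)%N) -> s = 1%g.
Proof.
move=> s_ge; apply/permP => i; rewrite perm1; apply/val_inj/esym/eqP => /=.
have sum_eq : (\sum_i (s i : nat) = \sum_(i < m) (i : nat))%N.
  by rewrite [RHS](reindex_inj (@perm_inj _ s)).
have := leqif_sum (fun i (_ : true) => leqif_eq (s_ge i)).
by move/leqifP; rewrite sum_eq ltnn; case: forallP => // /(_ i).
Qed.

Lemma perm_le_id m (s : 'S_m) : (forall i : 'I_m, (s i <= i)%N) -> s = 1%g.
Proof.
move=> s_le; rewrite -[s]invgK (@perm_ge_id _ (s^-1)%g) ?invg1 // => i.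
by have := s_le ((s^-1)%g i); rewrite permKV.
Qed.

Lemma perm_length1 m : perm_length (1%g : 'S_m) = 0.
Proof.
apply/eqP; rewrite cards_eq0 -subset0; apply/subsetP => p.
by rewrite !inE !perm1 => /andP[]; case: ltngtP.
Qed.

Section MinorImage.
Variables (K : fieldType) (n r : nat) (q : K) (A : algType K).
Variable ev : {lrmorphism Pq n r q -> A}.

Lemma qminor_diag m (B : 'I_m -> 'I_n) (J : 'I_m -> 'I_r) :
  (forall s : 'S_m, s != 1%g -> exists i, ev (Zg q (B i) (J (s i))) = 0) ->
  ev (qminor q B J) = \prod_(i < m) ev (Zg q (B i) (J i)).
Proof.
move=> s0; have evT (a : K) (s : 'S_m) :
    ev (a *: \prod_(i < m) Zg q (B i) (J (s i))) =
    a *: \prod_(i < m) ev (Zg q (B i) (J (s i))).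
  by rewrite -rmorph_prod; apply: linearZ.
rewrite /qminor rmorph_sum (bigD1 1%g) //= [X in _ + X]big1 ?addr0; last first.
  move=> s sn1; have [i si0] := s0 s sn1.
  by rewrite evT (prodr_eq0 (i := i)) ?mem_index_enum ?scaler0.
by rewrite evT perm_length1 expr0 scale1r; apply: eq_bigr => i _; rewrite perm1.
Qed.
End MinorImage.

(** * The commutation exponents *)

Definition diag_ix n r (al : 'I_n) (j : 'I_r) (i : 'I_(minn al j).+1) :
    'I_(n * r) := mxvec_index (chi_row i) (chi_col i).

Lemma diag_ix_inj n r (al : 'I_n) (j : 'I_r) : injective (@diag_ix n r al j).
Proof.
move=> i i' /(congr1 (@pair_of n r)); rewrite !mxvec_indexK => -[/eqP + _].
by rewrite eqn_add2l => /eqP/val_inj.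
Qed.

Lemma Tmx_diag n r (al : 'I_n) (j : 'I_r) x :
  Tmx n r x (mxvec_index al j) = (x \in @diag_ix n r al j @: setT)%:Z.
Proof.
case/mxvec_indexP: x => be k; rewrite !mxE !mxvec_indexK /=.
have -> : [exists x : 'I_(minn al j).+1,
    (be == al - x :> nat)%N && (k == j - x :> nat)%N] =
    (mxvec_index be k \in @diag_ix n r al j @: setT); last by case: ifP.
apply/existsP/imsetP => [[x /andP[/eqP bex /eqP kx]]|[i _ e]].
(* [chi_row] counts up from the top left corner of the minor, whereas [x] in T counts back from (al,
   j). *)
- exists (rev_ord x) => //; have := ltn_ord x => ltx.
  congr mxvec_index; apply/val_inj; rewrite /= ?bex ?kx; lia.
- exists (rev_ord i); have := ltn_ord i => lti.
  have := congr1 (@pair_of n r) e; rewrite !mxvec_indexK => -[-> ->] /=.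
  by apply/andP; split; lia.
Qed.

Lemma sum_Tmx n r (al : 'I_n) (j : 'I_r) (F : 'I_(n * r) -> int) :
  \sum_x Tmx n r x (mxvec_index al j) * F x =
  \sum_(i < (minn al j).+1) F (diag_ix i).
Proof.
rewrite (eq_bigr (fun x => if x \in @diag_ix n r al j @: setT then F x else 0)).
  rewrite -big_mkcond big_imset /=; last by move=> ? ? _ _; apply: diag_ix_inj.
  by apply: eq_bigl => i; rewrite inE.
by move=> x _; rewrite Tmx_diag; case: ifP; rewrite ?mul1r ?mul0r.
Qed.

Lemma Tmx_congr n r (H : 'M[int]_(n * r)) (al be : 'I_n) (j k : 'I_r) :
  ((Tmx n r)^T *m H *m Tmx n r) (mxvec_index al j) (mxvec_index be k) =
  \sum_(i < (minn al j).+1) \sum_(l < (minn be k).+1) H (diag_ix i) (diag_ix l).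
Proof.
rewrite -mulmxA mxE (eq_bigr (fun x =>
  Tmx n r x (mxvec_index al j) * (H *m Tmx n r) x (mxvec_index be k))).
  rewrite sum_Tmx; apply: eq_bigr => i _; rewrite mxE.
  by rewrite -sum_Tmx; apply: eq_bigr => y _; rewrite mulrC.
by move=> x _; rewrite mxE.
Qed.

Lemma Tmx_upper n r (x y : 'I_(n * r)) : (y < x)%N -> Tmx n r x y = 0.
Proof.
case/mxvec_indexP: y => al j; case/mxvec_indexP: x => be k.
rewrite !mxvec_indexE => lt; rewrite !mxE !mxvec_indexK /=.
case: existsP => // -[x /andP[/eqP bex /eqP kx]].
move: lt; rewrite bex kx ltnNge => /negP[].
by rewrite leq_add ?leq_mul2r ?leq_subr ?orbT.
Qed.

Lemma hcoef_skew n r al j be k : @hcoef n r be k al j = - hcoef al j be k.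
Proof.
rewrite /hcoef [be == _]eq_sym [k == _]eq_sym.
by do 2?case: ifP; rewrite ?opprB ?oppr0.
Qed.

Section ChiCommutation.
Variables (K : fieldType) (q : K) (n r : nat) (D : mondata n r).
Variable Phi : 'I_n -> 'I_r -> 'I_n -> 'I_r -> int.
Hypothesis q0 : q != 0.
Hypothesis PhiP : forall al j be i,
  Mmon q D al j * Zg q be i = q ^ Phi al j be i *: (Zg q be i * Mmon q D al j).

(** The order of the two diagonals makes their distance a natural number [g], the number of steps of
    the paths; the first minor then sits on the left edge of the band and the second on the right
    edge. *)
Lemma chi_qexponent (c : K) (a b : int) (al be : 'I_n) (j k : 'I_r) :
  j%:Z - al%:Z <= k%:Z - be%:Z ->
  chi q D a al j * chi q D b be k = c *: (chi q D b be k * chi q D a al j) ->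
  c = q ^ ((Tmx n r)^T *m Hmx Phi *m Tmx n r)
          (mxvec_index al j) (mxvec_index be k).
Proof.
set d := j%:Z - al%:Z => le_d.
have [g kg] : exists g : nat, k%:Z = be%:Z + d + g%:Z.
  by exists (absz (k%:Z - be%:Z - d)%R); lia.
have jd : j%:Z = al%:Z + d by rewrite /d addrC subrK.
have [ev evE] := Pq_universal (@path_gen_rel K n r q g d q0).
have rowE (be' : 'I_n) (k' : 'I_r) (i : 'I_(minn be' k').+1) :
    (chi_row i : nat)%:Z = be'%:Z - (minn be' k')%:Z + i%:Z by move=> /=; lia.
have colE (be' : 'I_n) (k' : 'I_r) (i : 'I_(minn be' k').+1) :
    (chi_col i : nat)%:Z = k'%:Z - (minn be' k')%:Z + i%:Z by move=> /=; lia.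
have evMinor1 : ev (qminor q (@chi_row n r al j) (@chi_col n r al j)) =
    \prod_(i < (minn al j).+1) ev (Zg q (chi_row i) (chi_col i)).
  apply: qminor_diag => s s1.
  (* Such an [i] puts the factor to the left of the band, where Z acts as 0. *)
  have [i lti] : exists i, (s i < i)%N.
    apply/existsP; apply: contraNT s1; rewrite negb_exists => /forallP s_ge.
    by apply/eqP/perm_ge_id => i; rewrite leqNgt.
  by exists i; rewrite (path_Z_out evE) // rowE colE; lia.
have evMinor2 : ev (qminor q (@chi_row n r be k) (@chi_col n r be k)) =
    \prod_(i < (minn be k).+1) ev (Zg q (chi_row i) (chi_col i)).
  apply: qminor_diag => s s1.
  (* Here the factor falls to the right of the band. *)
  have [i lti] : exists i : 'I_(minn be k).+1, (i < s i)%N.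
    apply/existsP; apply: contraNT s1; rewrite negb_exists => /forallP s_le.
    by apply/eqP/perm_le_id => i; rewrite leqNgt.
  by exists i; rewrite (path_Z_out evE) // rowE colE; lia.
have diag1 (i : 'I_(minn al j).+1) :
    (chi_col i : nat)%:Z = (chi_row i : nat)%:Z + d by rewrite rowE colE; lia.
have diag2 (i : 'I_(minn be k).+1) :
    (chi_col i : nat)%:Z = (chi_row i : nat)%:Z + d + g%:Z.
  by rewrite rowE colE; lia.
have evMZ al' j' be' k' : qcomm q (Phi al' j' be' k')
    (ev (Mmon q D al' j')) (ev (Zg q be' k')).
  by rewrite /qcomm -!rmorphM PhiP; apply: linearZ.
have evchi a' be' k' : ev (chi q D a' be' k') = q ^ a' *:
    (ev (qminor q (@chi_row n r be' k') (@chi_col n r be' k')) *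
     \prod_(i < (minn be' k').+1) ev (Mmon q D (chi_row i) (chi_col i))).
  by rewrite -rmorph_prod -rmorphM; apply: linearZ.
have lreg_chi (a' : int) (be' : 'I_n) (k' : 'I_r) :
    (forall i : 'I_(minn be' k').+1,
       GRing.lreg (ev (Zg q (chi_row i) (chi_col i)))) ->
    GRing.lreg (q ^ a' *:
      (\prod_(i < (minn be' k').+1) ev (Zg q (chi_row i) (chi_col i)) *
       \prod_(i < (minn be' k').+1) ev (Mmon q D (chi_row i) (chi_col i)))).
  move=> Zr; apply: lregZ; first exact: expfz_neq0.
  apply: lregM; apply: lreg_prod => // i; by apply: (path_Mmon_lreg evE q0).
have evZ e u : ev (e *: u) = e *: ev u by exact: linearZ.
have evM a1 al' j' a2 be' k' : ev (chi q D a1 al' j' * chi q D a2 be' k') =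
    ev (chi q D a1 al' j') * ev (chi q D a2 be' k') by exact: rmorphM.
move=> /(congr1 ev); rewrite evZ !evM !evchi evMinor1 evMinor2.
apply: qcomm_uniq.
  apply: lregM; apply: lreg_chi => i.
  - exact: (path_Z_last_lreg evE q0 (diag2 i)).
  - exact: (path_Z_first_lreg evE (diag1 i)).
apply: qcommZ.
(* H splits into the exponents of Z against Z, Z against M, M against Z, and M against M, the last
   being 0. *)
rewrite Tmx_congr; have -> :
  \sum_(i < (minn al j).+1) \sum_(l < (minn be k).+1)
      Hmx Phi (diag_ix i) (diag_ix l) =
    \sum_(i < (minn al j).+1) \sum_(l < (minn be k).+1)
      hcoef (chi_row i) (chi_col i) (chi_row l) (chi_col l)
    + \sum_(i < (minn al j).+1) \sum_(l < (minn be k).+1)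
      (- Phi (chi_row l) (chi_col l) (chi_row i) (chi_col i))
    + (\sum_(i < (minn al j).+1) \sum_(l < (minn be k).+1)
      Phi (chi_row i) (chi_col i) (chi_row l) (chi_col l)
    + \sum_(i < (minn al j).+1) \sum_(l < (minn be k).+1) 0).
  rewrite -!big_split /=; apply: eq_bigr => i _.
  rewrite -!big_split /=; apply: eq_bigr => l _.
  by rewrite mxE !mxvec_indexK /=; ring.
apply: qcommMl => //; apply: qcommMr => //;
  apply: qcomm_prodl => // i; apply: qcomm_prodr => // l.
- exact: path_Z_qcomm.
- exact: qcomm_sym.
- exact/qcomm_comm/(path_Mmon_comm evE).
Qed.

(** Congruence preserves skew-symmetry; this transfers the result to pairs of minors whose diagonals
    come in the opposite order. *)
Lemma Tmx_congr_skew (al be : 'I_n) (j k : 'I_r) :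
  ((Tmx n r)^T *m Hmx Phi *m Tmx n r) (mxvec_index be k) (mxvec_index al j) =
  - ((Tmx n r)^T *m Hmx Phi *m Tmx n r) (mxvec_index al j) (mxvec_index be k).
Proof.
rewrite !Tmx_congr exchange_big -sumrN; apply: eq_bigr => i _.
rewrite -sumrN; apply: eq_bigr => l _.
by rewrite !mxE !mxvec_indexK /= hcoef_skew; ring.
Qed.

End ChiCommutation.

Lemma expfz_inj (K : fieldType) (q : K) : q != 0 ->
  (forall m : nat, (0 < m)%N -> q ^+ m != 1) -> injective (exprz q).
Proof.
move=> q0 q_unity.
have le_inj (e f : int) : e <= f -> q ^ e = q ^ f -> e = f.
  move=> le_ef eqf; apply/eqP; apply: contraT => ne_ef.
  have := q_unity (absz (f - e)%R).
  rewrite absz_gt0 subr_eq0 eq_sym => /(_ ne_ef).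
  rewrite exprnP gez0_abs ?subr_ge0 // expfzDr // -eqf -expfzDr // subrr.
  by rewrite eqxx.
move=> e f; case: (lerP e f) => [|/ltW] le_ef eqf; first exact: le_inj.
exact/esym/le_inj.
Qed.

(* If q is a root of unity, the exponents are determined by the commutation    *)
(* relations only modulo the order of q, so the equality of matrices is then  *)
(* the equality of the powers of q; otherwise it is equality over the integers.*)
Theorem proposition2p11 (R : realType) (q : R[i]) (q0 : q != 0)
    (n r : nat) (n_gt0 : (0 < n)%N) (r_gt0 : (0 < r)%N)
    (D : mondata n r)
    (Phi : 'I_n -> 'I_r -> 'I_n -> 'I_r -> int)
    (PhiP : forall (al : 'I_n) (j : 'I_r) (be : 'I_n) (i : 'I_r),
      Mmon q D al j * Zg q be i =
        q ^ Phi al j be i *: (Zg q be i * Mmon q D al j))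
    (Phi_diag : forall (al : 'I_n) (j : 'I_r), Phi al j al j = 0)
    (a : 'M[int]_(n, r)) (aP : bar_normalized q D a)
    (Lambda : 'M[int]_(n * r)) (Lambda_skew : Lambda^T = - Lambda)
    (LambdaP : forall (al : 'I_n) (j : 'I_r) (be : 'I_n) (k : 'I_r),
      chi q D (a al j) al j * chi q D (a be k) be k =
        q ^ Lambda (mxvec_index al j) (mxvec_index be k) *:
          (chi q D (a be k) be k * chi q D (a al j) al j)) :
  [/\ (forall x y : 'I_(n * r), (y < x)%N -> Tmx n r x y = 0),
      (forall x y : 'I_(n * r),
         q ^ Lambda x y = q ^ ((Tmx n r)^T *m Hmx Phi *m Tmx n r) x y) &
      ((forall m : nat, (0 < m)%N -> q ^+ m != 1) ->
         Lambda = (Tmx n r)^T *m Hmx Phi *m Tmx n r)].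
Proof.
have expE x y : q ^ Lambda x y = q ^ ((Tmx n r)^T *m Hmx Phi *m Tmx n r) x y.
  case/mxvec_indexP: x => al j; case/mxvec_indexP: y => be k.
  have [le_d|/ltW le_d] := lerP (j%:Z - al%:Z) (k%:Z - be%:Z).
    exact: chi_qexponent q0 PhiP _ _ _ _ _ _ _ le_d (LambdaP _ _ _ _).
  (* The diagonals are in the opposite order: swap the minors and use that both matrices are
     skew. *)
  have := chi_qexponent q0 PhiP le_d (LambdaP _ _ _ _).
  rewrite Tmx_congr_skew -[Lambda (mxvec_index be k) _]opprK.
  have -> : - Lambda (mxvec_index be k) (mxvec_index al j)
      = Lambda (mxvec_index al j) (mxvec_index be k).
    have /matrixP/(_ (mxvec_index al j) (mxvec_index be k)) := Lambda_skew.
    by rewrite !mxE => ->; rewrite opprK.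
  by rewrite -!invr_expz => /invr_inj.
split=> // [x y|q_unity]; first exact: Tmx_upper.
by apply/matrixP => x y; apply: (expfz_inj q0 q_unity).
Qed.
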